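(* For any symmetric set $A \subset \Omega_{\kappa,n}$ with $\mathbb{P}_{\kappa,n}(A) \ge \frac{1}{2}$ and any $t \ge 0$, $$\mathbb{P}_{\kappa,n}\big( d_T(\cdot, A) \ge t \big) \le e \exp\Big( - \frac{t^2}{16(1-\frac n N)} \Big).$$
   Context: Let $L \ge 2$ be an integer, $\kappa = (\kappa_1,\ldots,\kappa_L)$ a vector of positive integers, $N = \kappa_1 + \cdots + \kappa_L$, and $\mathcal{X} = \{x_1,\ldots,x_L\} \subset \mathbb{R}$ a set of $L$ distinct reals. The multislice is $\Omega_\kappa = \{\omega \in \mathcal{X}^N : \#\{i : \omega_i = x_\ell\} = \kappa_\ell \text{ for } \ell = 1,\ldots,L\}$, with uniform distribution $\mathbb{P}_\kappa$. For $1 \le n \le N$ let $pr_n$ be the projection onto the first $n$ coordinates, $\Omega_{\kappa,n} := pr_n(\Omega_\kappa)$, and let $\mathbb{P}_{\kappa,n}$ be the push-forward of $\mathbb{P}_\kappa$ under $pr_n$. A set $A \subset \Omega_{\kappa,n}$ is symmetric if $\omega \in A$ implies $\sigma\omega \in A$ for every permutation $\sigma \in S_n$ (acting by permuting indices). Talagrand's convex distance is $$d_T(\omega, A) := \sup_{\alpha \in \mathbb{R}^n : |\alpha| = 1}\ \inf_{\omega' \in A} \sum_{i=1}^n |\alpha_i|\, \mathbf{1}_{\{\omega_i \neq \omega'_i\}},$$ where $|\alpha|$ is the Euclidean norm. If $n = N$, the exponential on the right-hand side is read as $0$ for $t > 0$ and as $1$ for $t = 0$. *)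

(* Defs.v *)
From HB Require Import structures.
From mathcomp Require Import all_boot all_order all_algebra all_fingroup.
From mathcomp Require Import finmap.
From mathcomp Require Import all_classical all_reals all_analysis.

Set Implicit Arguments.
Unset Strict Implicit.
Unset Printing Implicit Defensive.

Import Order.TTheory GRing.Theory Num.Theory.
Local Open Scope classical_set_scope.
Local Open Scope ring_scope.

Section Multislice.
Context {R : realType} {L : nat} (kappa : 'I_L -> nat) (x : 'I_L -> R).
Context {N : nat}.

(* Meaningful when x is injective and N is the sum of the kappa l. *)
Definition multislice : set 'rV[R]_N :=
  [set w : 'rV[R]_N | (forall i : 'I_N, exists l, w 0 i = x l) /\
           (forall l, #|[pred i | w 0 i == x l]| = kappa l)].

(* fset_set is the junk value fset0 on infinite sets; the multislice is finite,
   so both cardinals below are the true ones. *)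
Definition multislice_prob (B : set 'rV[R]_N) : R :=
  #|` fset_set (multislice `&` B)|%:R / #|` fset_set multislice|%:R.

Context {n : nat} (le_nN : (n <= N)%N).

Definition proj_first (w : 'rV[R]_N) : 'rV[R]_n :=
  \row_(i < n) w 0 (widen_ord le_nN i).

Definition multislice_proj : set 'rV[R]_n := proj_first @` multislice.

Definition multislice_proj_prob (B : set 'rV[R]_n) : R :=
  multislice_prob (proj_first @^-1` B).

End Multislice.

Section Talagrand.
Context {R : realType} {n : nat}.

Definition symmetric_set (A : set 'rV[R]_n) : Prop :=
  forall (s : 'S_n) (w : 'rV[R]_n), A w -> A (col_perm s w).

(* `|a| on matrices is the sup norm in MathComp-Analysis, hence this one. *)
Definition euclidean_norm (a : 'rV[R]_n) : R :=
  Num.sqrt (\sum_(i < n) a 0 i ^+ 2).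

(* The real-valued inf and sup are the genuine ones when A is nonempty and
   0 < n: the sums lie in [0, Num.sqrt n%:R]. *)
Definition convex_distance (w : 'rV[R]_n) (A : set 'rV[R]_n) : R :=
  sup [set inf [set \sum_(i < n) `|a 0 i| * (w 0 i != w' 0 i)%:R | w' in A]
      | a in [set a : 'rV[R]_n | euclidean_norm a = 1]].

End Talagrand.

(* For n = N the exponent is -t^2/0; the exponential is then read as its limit,
   0 for t > 0 and 1 for t = 0. *)
Definition gaussian_tail {R : realType} (n N : nat) (t : R) : R :=
  if n == N then (t == 0)%:R
  else expR (- (t ^+ 2 / (16 * (1 - n%:R / N%:R)))).

(* Main.v *)
Require Import Defs.
From HB Require Import structures.
From mathcomp Require Import all_boot all_order all_algebra all_fingroup.
From mathcomp Require Import finmap.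
From mathcomp Require Import all_classical all_reals all_analysis.
From mathcomp Require Import ring lra.

Set Implicit Arguments.
Unset Strict Implicit.
Unset Printing Implicit Defensive.

Import Order.TTheory GRing.Theory Num.Theory.
Local Open Scope classical_set_scope.
Local Open Scope ring_scope.

(** The uniform law on the multislice is the law of [w0] with its coordinates
permuted by a uniform permutation [s], for any fixed [w0] in the multislice.  So
the theorem is about the function [f s], the convex distance to [A] of the first
[n] coordinates of the permuted word, and it follows from an entropy inequality
on the symmetric group.

- Modified logarithmic Sobolev inequality ([modified_log_sobolev]): the entropy
  of a positive function [g] of a uniform permutation of [N] points is at most
  [1 / N] times the sum over ordered pairs of positions [i], [j] of the mean of
  [g s * (ln (g s) - ln (g (tperm i j * s)))].  The proof is
  by induction on the number of positions: condition on the value at one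
  position, and average over the choice of that position.

- Applied to [g = expR (l * f)], it bounds the entropy by
  [(W / N) * l ^+ 2] times the mean of [g], where [W] bounds the sum over
  [i] and [j] of the squared decreases of [f] under transpositions
  ([exp_entropy_le]).
  Herbst's argument integrates this differential inequality in [l] and yields
  [ln (mean (expR (l * f))) <= l * mean f + c * l ^+ 2] with [c = W / N]
  ([herbst]).

- For the convex distance, [W = 2 (N - n)].  A transposition within the first
  [n] positions does not change [f], since [A] is symmetric, and neither does
  one within the last [N - n].  For fixed [j >= n], a unit vector [a] that
  nearly attains the supremum for [s] bounds the decrease of [f] under the
  exchange of [i < n] with [j] by [`|a i|], so the squares sum to at most 1
  ([convex_distance_gradient]).  This is where the factor [1 - n / N] comes from:
  [c = 2 (1 - n / N)].

- Since [f] vanishes with probability at least one half, the exponential moment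
  cannot be as small as this bound unless [mean f ^+ 2 <= 4 c] ([mean_sq_le]).
  The exponential Markov inequality gives a tail at most
  [expR (- (t - mean f) ^+ 2 / (4 c))], and
  [(t - m) ^+ 2 >= t ^+ 2 / 2 - m ^+ 2] for [m = mean f] turns it into
  [e * expR (- t ^+ 2 / (8 c))] ([tail_le]).  When [n = N] the same bounds force
  [mean f = 0], that is [f = 0] ([tail_eq0]). *)

(** * The log-sum inequality *)

Lemma ln_sub_ge1V (R : realType) (z : R) : 0 < z -> 1 - z^-1 <= ln z.
Proof.
move=> z0; have zi : 0 < z^-1 by rewrite invr_gt0.
have := le_ln1Dx (x := z^-1 - 1).
rewrite subrKC lnV ?posrE// => h.
by have := h ltac:(lra); lra.
Qed.

Lemma sum_pos (R : realType) (I : finType) (P : pred I) (a : I -> R) i0 :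
  P i0 -> (forall i, 0 < a i) -> 0 < \sum_(i | P i) a i.
Proof.
move=> Pi0 a0; rewrite (bigD1 i0)//= ltr_wpDr//.
by apply: sumr_ge0 => i _; exact: ltW.
Qed.

(** Joint convexity of [(x, y) |-> x * ln (x / y)], from its tangent plane
[x * ln (A / B) + x - y * (A / B)] at [(A, B)]: summing the tangents, the last
two terms cancel.  All convexity in the entropy argument goes through this. *)
Lemma log_sum (R : realType) (I : finType) (P : pred I) (a b : I -> R) :
  (forall i, 0 < a i) -> (forall i, 0 < b i) ->
  (\sum_(i | P i) a i) * (ln (\sum_(i | P i) a i) - ln (\sum_(i | P i) b i))
  <= \sum_(i | P i) a i * (ln (a i) - ln (b i)).
Proof.
move=> a0 b0; set A := \sum_(i | P i) a i; set B := \sum_(i | P i) b i.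
have [[i0 Pi0]|noP] := pselect (exists i, P i); last first.
  have P0 : P =1 pred0.
    by move=> i; apply/negP => Pi; apply: noP; exists i.
  by rewrite /A !big_pred0// mul0r.
have A0 : 0 < A by exact: (sum_pos Pi0).
have B0 : 0 < B by exact: (sum_pos Pi0).
rewrite [leLHS](_ : _ = \sum_(i | P i)
    (a i * (ln A - ln B) + (a i - b i * (A / B)))); last first.
  rewrite big_split/= sumrB -!mulr_suml -/A -/B.
  by rewrite mulrCA divff ?gt_eqF// mulr1 subrr addr0.
apply: ler_sum => i _.
have /ln_sub_ge1V : 0 < (a i / b i) / (A / B) by rewrite !divr_gt0.
rewrite !ln_div ?posrE ?divr_gt0// => h.
have := ler_wpM2l (ltW (a0 i)) h.
have -> : a i * (1 - (a i / b i / (A / B))^-1) = a i - b i * (A / B).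
  by field; rewrite !gt_eqF ?a0 ?b0.
lra.
Qed.

(** * Sums over permutations supported in a set of positions *)

Section PermutationSums.
Context {T : finType}.
Implicit Types (F : {set T}) (s u : {perm T}) (i j k a b : T).
Local Open Scope group_scope.

Lemma perm_on_tperm F i j : i \in F -> j \in F -> perm_on F (tperm i j).
Proof.
move=> iF jF; apply/fintype.subsetP => x xij; have := fintype.subsetP (tperm_on i j) x xij.
by rewrite !inE => /orP[]/eqP->.
Qed.

Lemma perm_on_tpermMl F i j s : i \in F -> j \in F ->
  perm_on F (tperm i j * s) = perm_on F s.
Proof.
move=> iF jF.
have ton := perm_on_tperm iF jF.
apply/idP/idP => [h|]; last exact: perm_onM.
by rewrite -(tpermKg i j s); apply: perm_onM.
Qed.

Lemma perm_on_tpermMr F a b s : a \in F -> b \in F ->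
  perm_on F (s * tperm a b) = perm_on F s.
Proof.
move=> iF jF.
have ton := perm_on_tperm iF jF.
apply/idP/idP => [h|]; last by move=> h; apply: perm_onM.
by rewrite -(mulgK (tperm a b) s) tpermV; apply: perm_onM.
Qed.

Lemma tpermMl_image s i j : tperm i j * s = s * tperm (s i) (s j).
Proof. by rewrite -tpermJ conjgE mulgA mulgV mul1g. Qed.

Lemma perm_onD1 F i s : perm_on (F :\ i) s = perm_on F s && (s i == i).
Proof.
apply/idP/idP => [h|/andP[h /eqP si]].
  rewrite (out_perm h) ?eqxx ?andbT; last by rewrite !inE eqxx.
  by apply/fintype.subsetP => x /(fintype.subsetP h); rewrite !inE => /andP[].
apply/fintype.subsetP => x; rewrite !inE => sx.
apply/andP; split; first by apply: contra sx => /eqP->; rewrite si.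
by apply: (fintype.subsetP h); rewrite inE.
Qed.

Variables (R : realType).
Local Open Scope ring_scope.

Lemma sum_tpermMl F i j (h : {perm T} -> R) : i \in F -> j \in F ->
  \sum_(s | perm_on F s) h (tperm i j * s)%g = \sum_(s | perm_on F s) h s.
Proof.
move=> iF jF; rewrite [RHS](reindex_inj (mulgI (tperm i j))).
by apply: eq_bigl => s; rewrite perm_on_tpermMl.
Qed.

(** Permutations of [F] sending [i] to [a] are a coset of those of [F :\ i],
which is what makes an induction on [F] possible inside one type. *)
Lemma sum_fibre F i a (h : {perm T} -> R) : i \in F -> a \in F ->
  \sum_(s | perm_on F s && (s i == a)) h s
  = \sum_(u | perm_on (F :\ i) u) h (u * tperm i a)%g.
Proof.
move=> iF aF; rewrite (reindex_inj (mulIg (tperm i a))).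
apply: eq_bigl => s; rewrite perm_on_tpermMr// perm_onD1 permM; congr andb.
by rewrite -[X in _ == X](tpermL i a) (inj_eq perm_inj).
Qed.

Lemma sum_over_fibres F i (h : {perm T} -> R) : i \in F ->
  \sum_(s | perm_on F s) h s
  = \sum_(a in F) \sum_(s | perm_on F s && (s i == a)) h s.
Proof.
move=> iF; apply: (partition_big (fun s : {perm T} => s i) (mem F)).
by move=> s sF /=; rewrite (perm_closed _ sF).
Qed.

Lemma sum_perm_on F i (h : {perm T} -> R) : i \in F ->
  \sum_(s | perm_on F s) h s
  = \sum_(a in F) \sum_(u | perm_on (F :\ i) u) h (u * tperm i a)%g.
Proof.
by move=> iF; rewrite (sum_over_fibres _ iF); apply: eq_bigr => a aF; rewrite sum_fibre.
Qed.

End PermutationSums.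

(** * The modified logarithmic Sobolev inequality for transpositions *)

Section ModifiedLogSobolev.
Variables (R : realType) (T : finType).
Implicit Types (F : {set T}) (g : {perm T} -> R).

(** Entropy for the counting measure on the permutations of [F], that is
[#|F|`!] times the entropy for the uniform law. *)
Definition entropy_perm_on F g : R :=
  \sum_(s | perm_on F s) g s * ln (g s)
  - (\sum_(s | perm_on F s) g s)
    * (ln (\sum_(s | perm_on F s) g s) - ln (#|F|)`!%:R).

Definition fibre_sum F g (i a : T) : R :=
  \sum_(s | perm_on F s && (s i == a)) g s.

(** Summing over [s] and pairing [s] with [tperm i j * s] shows that this is half
of the sum of [(g s - g s') * (ln (g s) - ln (g s'))], the usual Dirichlet form
of [g] and [ln g].  Written as a relative entropy, it is covered by [log_sum]. *)
Definition transposition_form F g (i j : T) : R :=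
  \sum_(s | perm_on F s) g s * (ln (g s) - ln (g (tperm i j * s)%g)).

Lemma transposition_form_id F g i : transposition_form F g i i = 0.
Proof.
by apply: big1 => s _; rewrite tperm1 mul1g subrr mulr0.
Qed.

Lemma transposition_form_ge0 F g i j : (forall s, 0 < g s) ->
  i \in F -> j \in F -> 0 <= transposition_form F g i j.
Proof.
move=> g0 iF jF.
have := @log_sum R _ (perm_on F) g (fun s => g (tperm i j * s)%g) g0 (fun s => g0 _).
by rewrite sum_tpermMl// subrr mulr0.
Qed.

(** Bound on the entropy of the value at position [i].  Comparing each [G a]
with the average of the [G b] is, by convexity, at most comparing it with each
[G b].  The permutations with [i |-> a] and those with [i |-> b] are matched by
exchanging the values [a] and [b], which for [s] with [s i = a] is the same as
transposing the position [i] with the position of the value [b]. *)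
Lemma fibre_entropy_le F g i : (forall s, 0 < g s) -> i \in F ->
  let G := fibre_sum F g i in
  \sum_(a in F) G a * (ln (G a) - ln (\sum_(b in F) G b) + ln #|F|%:R)
  <= #|F|%:R^-1 * \sum_(j in F) transposition_form F g i j.
Proof.
move=> g0 iF /=; set G := fibre_sum F g i.
have G0 a : a \in F -> 0 < G a.
  move=> aF; apply: (@sum_pos _ _ _ _ (tperm i a)) => //.
  by rewrite tpermL eqxx andbT -[tperm i a]mulg1 perm_on_tpermMl// perm_on1.
have q0 : 0 < #|F|%:R :> R by rewrite ltr0n; apply/card_gt0P; exists i.
(* Extended by 1 off F so as to be positive everywhere. *)
pose G' a := if a \in F then G a else 1.
have G'0 a : 0 < G' a by rewrite /G'; case: ifP => // /G0.
have G'E : \sum_(b in F) G' b = \sum_(b in F) G b.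
  by apply: eq_bigr => b bF; rewrite /G' bF.
have S0 : 0 < \sum_(b in F) G b by rewrite -G'E; exact: (sum_pos iF).
rewrite mulrC ler_pdivlMr// mulr_suml.
have step1 a : a \in F ->
    G a * (ln (G a) - ln (\sum_(b in F) G b) + ln #|F|%:R) * #|F|%:R
    <= \sum_(b in F) G a * (ln (G a) - ln (G b)).
  move=> aF.
  have := @log_sum R _ (mem F) (fun=> G' a) G' (fun=> G'0 a) G'0.
  rewrite G'E sumr_const -(mulr_natr (G' a)) /G' aF lnM ?posrE ?G0// => h.
  rewrite [leRHS](_ : _ = \sum_(b in F) G a * (ln (G a) - ln (if b \in F then G b else 1))).
    by apply: le_trans h; rewrite le_eqVlt; apply/orP; left; apply/eqP; ring.
  by apply: eq_bigr => b bF; rewrite bF.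
apply: (le_trans (ler_sum _ step1)).
have step2 a b : a \in F -> b \in F ->
    G a * (ln (G a) - ln (G b)) <=
    \sum_(s | perm_on F s && (s i == a)) g s * (ln (g s) - ln (g (s * tperm a b)%g)).
  move=> aF bF.
  have := @log_sum R _ (fun s => perm_on F s && (s i == a)) g
    (fun s => g (s * tperm a b)%g) g0 (fun s => g0 _).
  rewrite -/(G a) (_ : \sum_(s | _) g (s * _)%g = G b)//.
  rewrite /G /fibre_sum [RHS](reindex_inj (mulIg (tperm a b))).
  apply: eq_bigl => s; rewrite perm_on_tpermMr// permM; congr andb.
  by rewrite -[X in _ = (_ == X)](tpermL a b) (inj_eq perm_inj).
have {}step2 : \sum_(a in F) \sum_(b in F) G a * (ln (G a) - ln (G b)) <=
    \sum_(a in F) \sum_(b in F) \sum_(s | perm_on F s && (s i == a))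
       g s * (ln (g s) - ln (g (s * tperm a b)%g)).
  by apply: ler_sum => a aF; apply: ler_sum => b bF; exact: step2.
apply: (le_trans step2); rewrite le_eqVlt; apply/orP; left; apply/eqP.
transitivity (\sum_(s | perm_on F s) \sum_(b in F)
    g s * (ln (g s) - ln (g (s * tperm (s i) b)%g))).
  rewrite [RHS](sum_over_fibres _ iF); apply: eq_bigr => a aF.
  rewrite exchange_big/=; apply: eq_bigr => s /andP[_ /eqP <-].
  by [].
rewrite [RHS]exchange_big/=; apply: eq_bigr => s sF.
rewrite (reindex_inj (@perm_inj _ s)) /=; apply: eq_big => [j|j _].
  by rewrite (perm_closed _ sF).
by rewrite tpermMl_image.
Qed.

(** Chain rule: conditional entropy given the value at [i], plus the entropy of
that value. *)
Lemma entropy_fibres F g i : (forall s, 0 < g s) -> i \in F ->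
  let G := fibre_sum F g i in
  entropy_perm_on F g =
    \sum_(a in F) entropy_perm_on (F :\ i) (fun u => g (u * tperm i a)%g)
    + \sum_(a in F) G a * (ln (G a) - ln (\sum_(b in F) G b) + ln #|F|%:R).
Proof.
move=> g0 iF /=; set G := fibre_sum F g i; rewrite /entropy_perm_on.
have q0 : 0 < #|F|%:R :> R by rewrite ltr0n; apply/card_gt0P; exists i.
rewrite (sum_over_fibres (fun s => g s * ln (g s)) iF) (sum_over_fibres g iF).
rewrite -(eq_bigr G (fun a _ => erefl))//.
rewrite mulr_suml -sumrB -big_split/=; apply: eq_bigr => a aF.
rewrite -!(sum_fibre (i := i)) // -/(fibre_sum F g i a) -/(G a).
rewrite (_ : (#|F|)`!%:R = #|F|%:R * (#|F :\ i|)`!%:R :> R).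
  rewrite lnM ?posrE ?ltr0n ?fact_gt0//; last by rewrite -(ltr0n R).
  by rewrite (sum_fibre (fun s => g s * ln (g s)))//; ring.
by rewrite -natrM (cardsD1 i F) iF add1n factS.
Qed.

(** Each pair of distinct positions avoids [i] for [#|F| - 2] choices of [i]. *)
Lemma sum_setD1_form F (S : T -> T -> R) : (forall i, S i i = 0) ->
  (\sum_(i in F) \sum_(j in F :\ i) \sum_(k in F :\ i) S j k
  = (#|F|%:R - 2) * \sum_(j in F) \sum_(k in F) S j k)%R.
Proof.
move=> S0; set t := \sum_(j in F) \sum_(k in F) S j k.
have D1 i (h : T -> R) : i \in F -> \sum_(j in F :\ i) h j = \sum_(j in F) h j - h i.
  by move=> iF; rewrite [in RHS](big_setD1 i)//= addrC addrK.
transitivity (\sum_(i in F) (t - \sum_(k in F) S i k - \sum_(j in F) S j i)).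
  apply: eq_bigr => i iF.
  rewrite (eq_bigr (fun j => \sum_(k in F) S j k - S j i)) => [|j _]; last exact: D1.
  by rewrite sumrB !D1// S0 subr0.
have tC : \sum_(i in F) \sum_(j in F) S j i = t by exact: exchange_big.
by rewrite !sumrB -/t tC sumr_const -(mulr_natr t); ring.
Qed.

(** With [t] the right-hand side and [q = #|F| - 1], averaging the chain rule
over the position [i] gives [#|F| * entropy <= ((q - 1) / q + 1 / (q + 1)) * t],
and the bracket is at most 1. *)
Lemma modified_log_sobolev F g : (forall s, 0 < g s) ->
  #|F|%:R * entropy_perm_on F g
  <= \sum_(i in F) \sum_(j in F) transposition_form F g i j.
Proof.
elim: {F}#|F| {-2}F g (erefl #|F|) => [|q IH] F g cF g0.
  move/eqP: cF; rewrite cards_eq0 => /eqP ->.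
  by rewrite cards0 mul0r big_set0.
set t := \sum_(i in F) _.
have t0 : 0 <= t.
  by do 2!(apply: sumr_ge0 => ? ?); exact: transposition_form_ge0.
have sum_le i : i \in F -> q%:R * entropy_perm_on F g <=
    \sum_(j in F :\ i) \sum_(k in F :\ i) transposition_form F g j k
    + q%:R / q.+1%:R * \sum_(j in F) transposition_form F g i j.
  move=> iF; rewrite (entropy_fibres g0 iF) mulrDr lerD//.
    have cFi : #|F :\ i| = q by move: cF; rewrite (cardsD1 i) iF => -[].
    rewrite mulr_sumr.
    apply: (@le_trans _ _ (\sum_(a in F) \sum_(j in F :\ i) \sum_(k in F :\ i)
        transposition_form (F :\ i) (fun u => g (u * tperm i a)%g) j k)).
      apply: ler_sum => a aF.
      have := IH (F :\ i) (fun u => g (u * tperm i a)%g) cFi (fun u => g0 _).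
      by rewrite cFi.
    rewrite exchange_big/=; apply: ler_sum => j _.
    rewrite exchange_big/=; apply: ler_sum => k _.
    rewrite /transposition_form (sum_perm_on _ iF).
    by apply: ler_sum => a _; apply: ler_sum => u _; rewrite mulgA.
  rewrite -mulrA ler_wpM2l// -cF.
  exact: fibre_entropy_le.
have := ler_sum (index_enum T) (P := mem F) sum_le.
rewrite sumr_const cF big_split/= -mulr_sumr -/t.
rewrite sum_setD1_form; last exact: transposition_form_id.
rewrite -/t cF -(mulr_natr (_ * _)) => h.
case: q IH cF h {sum_le} => [_|q IH] cF h.
  (* a single point carries no entropy *)
  have [i iF] : exists i, i \in F by apply/card_gt0P; rewrite cF.
  have perm1 s : perm_on F s = (s == 1%g).
    apply/idP/eqP => [sF|->]; last exact: perm_on1.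
    by apply: perm_on_id sF _; rewrite cF.
  rewrite /entropy_perm_on !(big_pred1 1%g)// cF (_ : 1`! = 1)%N// ln1 subr0 subrr mulr0.
  exact: t0.
have q0 : 0 < q.+1%:R :> R by rewrite ltr0n.
rewrite -(ler_pM2l q0) mulrA (mulrAC q.+1%:R).
apply: (le_trans h); rewrite -mulrDl ler_wpM2r//.
have : q.+1%:R / q.+2%:R <= 1 :> R by rewrite ler_pdivrMr ?ltr0n// mul1r ler_nat.
by rewrite -[q.+2]addn1 natrD; lra.
Qed.
End ModifiedLogSobolev.

(** * Herbst's argument *)

Section Herbst.
Variables (R : realType) (I : finType) (f : I -> R) (c : R).

Definition mean (h : I -> R) : R := (\sum_i h i) / #|I|%:R.

Definition log_mgf (l : R) : R := ln (mean (fun i => expR (l * f i))).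

Lemma is_derive_bigsum (J : Type) (r : seq J) (h dh : J -> R -> R) (x : R) :
  (forall j, is_derive x 1 (h j) (dh j x)) ->
  is_derive x 1 (fun y => \sum_(j <- r) h j y) (\sum_(j <- r) dh j x).
Proof.
move=> hd; elim: r => [|j r IH].
  rewrite big_nil (_ : (fun y => _) = cst 0); first exact: is_derive_cst.
  by apply/funext => y; rewrite big_nil.
rewrite big_cons (_ : (fun y => _) = (h j) \+ (fun y => \sum_(j <- r) h j y)).
  exact: is_deriveD.
by apply/funext => y; rewrite big_cons.
Qed.

Lemma is_derive_mgf (x : R) :
  is_derive x 1 (fun l => mean (fun i => expR (l * f i)))
    (mean (fun i => f i * expR (x * f i))).
Proof.
rewrite /mean.
have hd i : is_derive x 1 (fun y : R => expR (y * f i)) (f i * expR (x * f i)).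
  have d0 : is_derive x 1 (fun y : R => y * f i) (f i).
    apply: (is_derive_eq (is_deriveM (is_derive_id x (1 : R^o)) (is_derive_cst (f i) x (1 : R^o)))).
    by rewrite scaler0 add0r /GRing.scale/= mulr1.
  have d1 : is_derive x 1 (expR \o (fun y : R => y * f i)) (expR (x * f i) * f i).
    exact: is_derive1_comp.
  by apply: (is_derive_eq d1); rewrite mulrC.
have := is_derive_bigsum (index_enum I) (dh := fun i x => f i * expR (x * f i)) hd.
move=> hs.
have hz := is_deriveZ (#|I|%:R^-1 : R) hs.
rewrite (_ : (fun l => _) = (#|I|%:R^-1 \*: (fun y : R => \sum_i expR (y * f i)))).
  by apply: (is_derive_eq hz); rewrite mulrC.
by apply/funext => y /=; rewrite mulrC.
Qed.

Hypothesis I_gt0 : (0 < #|I|)%N.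

Let M0 : 0 < #|I|%:R :> R. Proof. by rewrite ltr0n. Qed.

Lemma mgf_gt0 l : 0 < mean (fun i => expR (l * f i)).
Proof.
have /card_gt0P[i _] := I_gt0.
by rewrite divr_gt0//; apply: (@sum_pos _ _ _ _ i) => // j; exact: expR_gt0.
Qed.

Hypothesis c_ge0 : 0 <= c.
Hypothesis f_ge0 : forall i, 0 <= f i.

(** This identifies the limit of [log_mgf l / l] at [0], the starting point of
the integration in [herbst]: only the upper bound matters there. *)
Lemma log_mgf_le_small (l : R) (B : R) : (forall i, f i <= B) -> 0 < l ->
  log_mgf l <= l * mean f * expR (l * B).
Proof.
move=> fB l0.
have ln_le : log_mgf l <= mean (fun i => expR (l * f i)) - 1.
  have := @le_ln1Dx _ (mean (fun i => expR (l * f i)) - 1).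
  by rewrite subrKC; apply; have := mgf_gt0 l; lra.
apply: le_trans ln_le _.
rewrite [X in _ - X](_ : 1 = (\sum_(i : I) 1) / #|I|%:R); last first.
  by rewrite sumr_const divff// gt_eqF.
rewrite /mean -mulrBl mulrA mulrAC ler_pM2r ?invr_gt0//.
rewrite -sumrB mulr_sumr mulr_suml; apply: ler_sum => i _.
have y0 : 0 <= l * f i by rewrite mulr_ge0// ltW.
apply: (@le_trans _ _ (l * f i * expR (l * f i))); last first.
  by rewrite ler_wpM2l// ler_expR ler_wpM2l// ltW.
have := expR_ge1Dx (- (l * f i)).
rewrite expRN -(ler_pM2r (expR_gt0 (l * f i))) mulVf ?gt_eqF ?expR_gt0//.
lra.
Qed.

Hypothesis entropy_le : forall l, 0 < l ->
  mean (fun i => l * f i * expR (l * f i))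
    - mean (fun i => expR (l * f i)) * log_mgf l
  <= c * l ^+ 2 * mean (fun i => expR (l * f i)).

(** The derivative of [log_mgf l / l] is the entropy of [expR (l * f)] divided by
[l ^+ 2] times the mean of [expR (l * f)], hence at most [c]. *)
Lemma herbst_decreasing (a b : R) : 0 < a -> a <= b ->
  log_mgf b / b - c * b <= log_mgf a / a - c * a.
Proof.
move=> a0 ab.
pose h (x : R) := log_mgf x / x - c * x.
pose dh (x : R) := mean (fun i => f i * expR (x * f i))
   / mean (fun i => expR (x * f i)) / x - log_mgf x / x ^+ 2 - c.
have hd (x : R) : 0 < x -> is_derive x 1 h (dh x).
  move=> x0.
  have d1 : is_derive x 1 log_mgf
    ((mean (fun i => expR (x * f i)))^-1 * mean (fun i => f i * expR (x * f i))).
    apply: is_derive1_comp; last exact: is_derive_mgf.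
    exact: is_derive1_ln (mgf_gt0 x).
  have d2 := @is_deriveV R id x 1 1 (lt0r_neq0 x0) (is_derive_id x (1 : R^o)).
  have d3 := is_deriveZ c (is_derive_id x (1 : R^o)).
  have d4 := is_deriveB (is_deriveM d1 d2) d3.
  apply: (is_derive_eq d4); rewrite /GRing.scale/= /dh.
  by field; rewrite !gt_eqF ?mgf_gt0.
have h' x : 0 < x -> derivable h x 1 by move=> /hd [].
apply: (@ler0_derive1_nincr R h a b) => //.
- move=> x; rewrite in_itv/= => /andP[ax _]; apply: h'; lra.
- move=> x; rewrite in_itv/= => /andP[ax _].
  have x0 : 0 < x by lra.
  have := hd x x0 => xd; rewrite derive1E (@derive_val _ _ _ _ _ _ _ xd) /dh.
  have := entropy_le x0; have := mgf_gt0 x.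
  rewrite [X in X - _ <= _](_ : _ = x * mean (fun i => f i * expR (x * f i))); last first.
    rewrite /mean mulrA mulr_sumr; congr (_ / _).
    by apply: eq_bigr => i _; rewrite mulrA.
  set Z := mean (fun i => expR (x * f i)); set Z' := mean _ => Z0 h1.
  have -> : Z' / Z / x - log_mgf x / x ^+ 2 - c
     = (x * Z' - Z * log_mgf x - c * x ^+ 2 * Z) / (Z * x ^+ 2).
    by field; rewrite !gt_eqF.
  rewrite ler_pdivrMr ?mul0r; last by rewrite mulr_gt0// exprn_gt0.
  lra.
- apply: derivable_within_continuous => x; rewrite in_itv/= => /andP[ax _].
  apply: h'; lra.
Qed.

Lemma herbst (l : R) : 0 < l -> log_mgf l <= l * mean f + c * l ^+ 2.
Proof.
move=> l0.
pose B := \sum_i f i.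
have fB i : f i <= B.
  by rewrite /B (bigD1 i)//= lerDl sumr_ge0.
have B0 : 0 <= B by exact: sumr_ge0.
have m0 : 0 <= mean f by rewrite divr_ge0// ltW.
(* d is so small that expR (d * B) <= 1 + e / (mean f + 1). *)
have main e : 0 < e -> log_mgf l / l - c * l <= mean f + e.
  move=> e0.
  pose u := ln (1 + e / (mean f + 1)).
  have m1 : 0 < mean f + 1 by lra.
  have r0 : 0 < e / (mean f + 1) by rewrite divr_gt0.
  have u0 : 0 < u by rewrite /u ln_gt0// ltrDl.
  pose d := Num.min l (u / (B + 1)).
  have d0 : 0 < d by rewrite /d lt_min l0 divr_gt0//; lra.
  have dl : d <= l by rewrite /d ge_min lexx.
  have dB : d * B <= u.
    apply: (@le_trans _ _ (d * (B + 1))); first by rewrite ler_wpM2l ?lerDl ?ltW.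
    by rewrite -ler_pdivlMr ?ge_min ?lexx ?orbT//; lra.
  apply: le_trans (herbst_decreasing d0 dl) _.
  have cd0 : 0 <= c * d by rewrite mulr_ge0// ltW.
  apply: (@le_trans _ _ (log_mgf d / d)); first lra.
  rewrite ler_pdivrMr//; apply: le_trans (log_mgf_le_small fB d0) _.
  rewrite mulrC mulrCA [leRHS]mulrC ler_pM2l//.
  have eB : expR (d * B) <= 1 + e / (mean f + 1).
    rewrite -[leRHS]lnK ?posrE ?ler_expR//; lra.
  apply: (@le_trans _ _ ((1 + e / (mean f + 1)) * mean f)); first by rewrite ler_wpM2r.
  rewrite mulrDl mul1r lerD2l mulrAC ler_pdivrMr// ler_pM2l//; lra.
rewrite -(ler_pM2l (x := l^-1)) ?invr_gt0//.
rewrite mulrC mulrDr mulrA mulVf ?gt_eqF// mul1r.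
rewrite (_ : l^-1 * (c * l ^+ 2) = c * l); last by field; rewrite gt_eqF.
by rewrite -lerBlDr; apply/ler_addgt0Pr.
Qed.
End Herbst.

(** * From exponential moments to tails *)

Section TailFromHerbst.
Variables (R : realType) (I : finType) (f : I -> R) (c : R).
Hypothesis I_gt0 : (0 < #|I|)%N.
Hypothesis f_ge0 : forall i, 0 <= f i.
Hypothesis c_ge0 : 0 <= c.
Hypothesis log_mgf_le : forall l, 0 < l -> log_mgf f l <= l * mean f + c * l ^+ 2.

Let M0 : 0 < #|I|%:R :> R. Proof. by rewrite ltr0n. Qed.

Lemma mean_le (g h : I -> R) : (forall i, g i <= h i) -> mean g <= mean h.
Proof. by move=> gh; rewrite ler_pM2r ?invr_gt0//; apply: ler_sum. Qed.

Lemma mean_affine (g h : I -> R) (x y z : R) :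
  mean (fun i => x * g i - y + z * h i) = x * mean g - y + z * mean h.
Proof.
rewrite /mean big_split/= sumrB -!mulr_sumr sumr_const -(mulr_natr y).
by field; rewrite gt_eqF.
Qed.

Lemma mgf_le (l : R) : 0 < l ->
  mean (fun i => expR (l * f i)) <= expR (l * mean f + c * l ^+ 2).
Proof.
by move=> l0; rewrite -[leLHS]lnK ?posrE ?mgf_gt0// ler_expR log_mgf_le.
Qed.

(** If [f] vanishes on half of the space, its mean must come from the other half,
so the exponential moment at [l = 1 / m], where [m = mean f], is at least
[(1 + e ^+ 2) / 2]; the tangent of the exponential at 2 proves this pointwise.
It exceeds [expR (1 + c / m ^+ 2)] as soon as [c / m ^+ 2 < 1 / 4]. *)
Lemma mean_sq_le : 1 / 2 <= mean (fun i => (f i == 0)%:R) :> R -> mean f ^+ 2 <= 4 * c.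
Proof.
move=> half; rewrite leNgt; apply/negP => cm.
set m : R := mean f in cm *.
have m0 : 0 < m.
  rewrite lt0r; apply/andP; split; last by rewrite /m /mean divr_ge0 ?ler0n ?sumr_ge0.
  by apply: contraTneq cm => ->; rewrite expr0n/= -leNgt mulr_ge0.
have l0 : 0 < m^-1 by rewrite invr_gt0.
have up : mean (fun i => expR (m^-1 * f i)) <= expR (5 / 4).
  apply: le_trans (mgf_le l0) _; rewrite ler_expR -/m mulVf ?gt_eqF//.
  have : c * m^-1 ^+ 2 <= 1 / 4.
    by rewrite exprVn ler_pdivrMr ?exprn_gt0//; lra.
  lra.
set e := expR (1 : R).
have e0 : 0 < e by exact: expR_gt0.
have low : (1 + e ^+ 2) / 2 <= mean (fun i => expR (m^-1 * f i)).
  apply: (@le_trans _ _ (mean (fun i =>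
    (e ^+ 2 * m^-1) * f i - e ^+ 2 + (1 + e ^+ 2) * (f i == 0)%:R))).
    rewrite mean_affine -/m -mulrA mulVf ?gt_eqF// mulr1 subrr add0r.
    by rewrite ler_pM2l ?ltr_wpDr ?exprn_ge0 ?(ltW e0)//; move: half; rewrite div1r.
  apply: mean_le => i; have [->|fi0] := eqVneq (f i) 0.
    by rewrite !mulr0 expR0 mulr1; lra.
  rewrite mulr0 addr0.
  have := expR_ge1Dx (m^-1 * f i - 2).
  rewrite expRB (_ : expR 2 = e ^+ 2); last by rewrite /e -expRM_natl mulr1.
  rewrite ler_pdivlMr ?exprn_gt0//; lra.
have := le_trans low up; apply/negP; rewrite -ltNge.
set z := expR (1 / 4 : R).
have z0 : 0 < z by exact: expR_gt0.
have ez : e = z ^+ 4 by rewrite /e /z -expRM_natl; congr expR; lra.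
have -> : expR (5 / 4 : R) = z ^+ 5 by rewrite /z -expRM_natl; congr expR; lra.
have z1 : 5 / 4 <= z by have := expR_ge1Dx (1 / 4 : R); rewrite -/z; lra.
have zu : z <= 4 / 3.
  have := expR_ge1Dx (- (1 / 4) : R); rewrite expRN -/z -(ler_pM2r z0) mulVf ?gt_eqF//; lra.
rewrite ez.
(* In terms of z = e^(1/4), the claim is 2 z^5 < 1 + z^8. *)
have z3 : 125 / 64 <= z ^+ 3.
  by rewrite (_ : 125 / 64 = (5 / 4) ^+ 3); [apply: lerXn2r; rewrite ?nnegrE; lra|field].
have z5 : z ^+ 5 <= 1024 / 243.
  by rewrite (_ : 1024 / 243 = (4 / 3) ^+ 5); [apply: lerXn2r; rewrite ?nnegrE; lra|field].
have z50 : 0 < z ^+ 5 by rewrite exprn_gt0.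
have -> : (z ^+ 4) ^+ 2 = z ^+ 5 * z ^+ 3 by ring.
by nra.
Qed.

Lemma tail_le (t : R) : 1 / 2 <= mean (fun i => (f i == 0)%:R) :> R -> 0 < c -> 0 <= t ->
  mean (fun i => ((t <= f i)%R : nat)%:R) <= expR 1 * expR (- (t ^+ 2 / (8 * c))).
Proof.
move=> half c0 t0; have := mean_sq_le half; set m := mean f => m2.
have m0 : 0 <= m by rewrite /m /mean divr_ge0 ?ler0n ?sumr_ge0.
have P1 : mean (fun i => ((t <= f i)%R : nat)%:R) <= 1 :> R.
  rewrite ler_pdivrMr// mul1r -sum1_card natr_sum ler_sum// => i _.
  by rewrite ler_nat leq_b1.
rewrite -expRD; have [tm|mt] := leP t m.
  apply: le_trans P1 _; rewrite -[leLHS]expR0 ler_expR subr_ge0 ler_pdivrMr ?mulr_gt0//.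
  have : t ^+ 2 <= m ^+ 2 by rewrite ler_sqr ?nnegrE.
  lra.
(* The minimiser of l * m + c * l ^+ 2 - l * t. *)
pose l := (t - m) / (2 * c).
have l0 : 0 < l by rewrite divr_gt0 ?mulr_gt0// subr_gt0.
apply: (@le_trans _ _ (mean (fun i => expR (l * f i)) * expR (- (l * t)))).
  rewrite /mean mulrAC ler_pM2r ?invr_gt0// mulr_suml ler_sum// => i _.
  rewrite -expRD; case: (leP t (f i)) => [tf|_]; last exact: expR_ge0.
  by rewrite -[leLHS]expR0 ler_expR subr_ge0 ler_pM2l.
apply: (@le_trans _ _ (expR (l * m + c * l ^+ 2) * expR (- (l * t)))).
  by rewrite ler_pM2r ?expR_gt0// mgf_le.
rewrite -expRD ler_expR.
rewrite (_ : _ + _ = - ((t - m) ^+ 2 / (4 * c))); last first.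
  by rewrite /l; field; rewrite gt_eqF.
rewrite -subr_ge0 (_ : _ - _ = ((8 * c - 2 * m ^+ 2) + (t - 2 * m) ^+ 2) / (8 * c)); last first.
  by field; rewrite gt_eqF.
have := sqr_ge0 (t - 2 * m) => h.
by rewrite divr_ge0//; lra.
Qed.

Lemma tail_eq0 (t : R) : 1 / 2 <= mean (fun i => (f i == 0)%:R) :> R -> c = 0 -> 0 < t ->
  mean (fun i => ((t <= f i)%R : nat)%:R) = 0 :> R.
Proof.
move=> half c0 t0; have := mean_sq_le half; rewrite c0 mulr0 => m2.
have /eqP : mean f ^+ 2 = 0 by apply/eqP; rewrite eq_le m2 sqr_ge0.
rewrite sqrf_eq0 mulf_eq0 invr_eq0 (gt_eqF M0) orbF psumr_eq0// => /allP f0.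
rewrite /mean big1 ?mul0r// => i _.
by rewrite (eqP (f0 i _)) ?mem_index_enum// leNgt t0.
Qed.

End TailFromHerbst.

(** * Exponential entropy on the symmetric group *)

Section SymmetricGroup.
Variables (R : realType) (T : finType) (f : {perm T} -> R) (W : R).
Implicit Types s : {perm T}.

(** Adding the two orientations of a transposition leaves only decreases of the
function, weighted by the larger exponential; hence one-sided increments suffice
in [W_bound]. *)
Lemma exp_increment_le (x y : R) :
  expR x * (x - y) + expR y * (y - x)
  <= expR x * Num.max (x - y) 0 ^+ 2 + expR y * Num.max (y - x) 0 ^+ 2.
Proof.
wlog xy : x y / y <= x.
  move=> H; have [/H//|/ltW/H] := leP y x.
  by rewrite addrC [leRHS]addrC.
rewrite (max_idPl _) ?subr_ge0// (max_idPr _) ?subr_le0// expr0n/= mulr0 addr0.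
rewrite (_ : _ + _ = (expR x - expR y) * (x - y)); last by ring.
rewrite expr2 mulrA ler_wpM2r ?subr_ge0//.
have := expR_ge1Dx (y - x); rewrite expRB ler_pdivlMr ?expR_gt0//.
have := expR_gt0 x; nra.
Qed.

Hypothesis W_bound : forall s,
  \sum_i \sum_j Num.max (f s - f (tperm i j * s)%g) 0 ^+ 2 <= W.
Hypothesis T_gt0 : (0 < #|T|)%N.

Lemma exp_entropy_le (l : R) : 0 < l ->
  mean (fun s => l * f s * expR (l * f s))
    - mean (fun s => expR (l * f s)) * log_mgf f l
  <= W / #|T|%:R * l ^+ 2 * mean (fun s => expR (l * f s)).
Proof.
move=> l0.
pose U : {set T} := finset.setT.
pose g s := expR (l * f s).
have g0 s : 0 < g s by exact: expR_gt0.
have T0 : 0 < #|T|%:R :> R by rewrite ltr0n.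
have onT (h : {perm T} -> R) : \sum_(s | perm_on U s) h s = \sum_s h s.
  by apply: eq_bigl => s; apply/fintype.subsetP => x _; rewrite inE.
have cardT : (#|U|)`! = #|{perm T}|.
  by rewrite -card_perm; apply: eq_card => s; apply/fintype.subsetP => x _; rewrite inE.
have M0 : 0 < #|{perm T}|%:R :> R by rewrite -cardT ltr0n fact_gt0.
have Z0 : 0 < \sum_s g s by apply: (@sum_pos _ _ _ _ 1%g).
have := modified_log_sobolev U g0.
rewrite /entropy_perm_on !onT cardT cardsT => ent.
have formE i j : transposition_form U g i j
    <= l ^+ 2 * \sum_s g s * Num.max (f s - f (tperm i j * s)%g) 0 ^+ 2.
  rewrite /transposition_form onT.
  pose a s := g s * (l * f s - l * f (tperm i j * s)%g).
  pose b s := g s * Num.max (l * f s - l * f (tperm i j * s)%g) 0 ^+ 2.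
  have inv (h : {perm T} -> R) : \sum_s h (tperm i j * s)%g = \sum_s h s.
    by rewrite [RHS](reindex_inj (mulgI (tperm i j))).
  have ab : \sum_s a s <= \sum_s b s.
    suff : \sum_s a s + \sum_s a (tperm i j * s)%g
        <= \sum_s b s + \sum_s b (tperm i j * s)%g.
      by rewrite !inv; lra.
    rewrite -!big_split/=; apply: ler_sum => s _.
    by rewrite /a /b !tpermKg; exact: exp_increment_le.
  rewrite (eq_bigr a) => [|s _]; last by rewrite /g !expRK.
  apply: le_trans ab _; rewrite mulr_sumr ler_sum// => s _.
  rewrite /b (_ : Num.max _ 0 = l * Num.max (f s - f (tperm i j * s)%g) 0).
    by rewrite exprMn mulrCA.
  by rewrite maxr_pMr ?(ltW l0)// mulr0 mulrBr.
have {}ent : #|T|%:R * (\sum_s g s * ln (g s)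
    - (\sum_s g s) * (ln (\sum_s g s) - ln #|{perm T}|%:R))
    <= l ^+ 2 * W * \sum_s g s.
  apply: (le_trans ent).
  apply: (@le_trans _ _ (\sum_(i in U) \sum_(j in U)
     (l ^+ 2 * \sum_s g s * Num.max (f s - f (tperm i j * s)%g) 0 ^+ 2))).
    by do 2!(apply: ler_sum => ? _); exact: formE.
  under eq_bigl do rewrite inE.
  under eq_bigr do under eq_bigl do rewrite inE.
  under eq_bigr do (rewrite -mulr_sumr exchange_big/=).
  rewrite -mulr_sumr exchange_big/= -mulrA ler_pM2l ?exprn_gt0// mulr_sumr.
  apply: ler_sum => s _; under eq_bigr do rewrite -mulr_sumr.
  by rewrite -mulr_sumr mulrC ler_pM2r// W_bound.
rewrite /log_mgf /mean lnM ?posrE ?invr_gt0// lnV ?posrE//.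
rewrite -/g -(ler_pM2l T0) -(ler_pM2r M0).
apply: le_trans (le_trans ent _).
  rewrite le_eqVlt; apply/orP; left; apply/eqP.
  rewrite (eq_bigr (fun s => g s * ln (g s))) => [|s _]; last by rewrite /g expRK mulrC.
  by rewrite -/g; field; rewrite gt_eqF.
rewrite le_eqVlt; apply/orP; left; apply/eqP.
by rewrite -/g; field; rewrite !gt_eqF.
Qed.

End SymmetricGroup.

(** * The multislice as an orbit of the symmetric group *)

Section Orbit.
Variables (R : realType) (L N : nat) (kappa : 'I_L -> nat) (x : 'I_L -> R).
Variable (w0 : 'rV[R]_N).
Hypothesis w0P : multislice kappa x w0.

Lemma multislice_orbit : multislice kappa x = range (fun s : 'S_N => col_perm s w0).
Proof.
have [w0x w0k] := w0P.
apply/seteqP; split => [w [wx wk]|_ [s _ <-]]; last first.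
  split=> [i|l]; first by rewrite mxE; exact: w0x.
  rewrite -(w0k l) -!sum1_card [RHS](reindex_inj (@perm_inj _ s)).
  by apply: eq_bigl => i; rewrite !inE mxE.
pose tw (v : 'rV[R]_N) := [tuple v 0 i | i < N].
have countE (v : 'rV[R]_N) y : count_mem y (tw v) = #|[pred i | v 0 i == y]|.
  by rewrite /= enumT count_map cardE /enum_mem size_filter; apply: eq_count.
have /tuple_permP[s ws] : perm_eq (tw w) (tw w0).
  apply/allP => y /=; rewrite mem_cat => yw.
  have [l ->] : exists l, y = x l.
    by case/orP: yw => /mapP[i _ ->]; [exact: wx|exact: w0x].
  by rewrite !countE wk w0k.
exists s => //; apply/rowP => i; rewrite mxE.
have := congr1 (fun t : seq R => nth 0 t i) ws.
by rewrite -!tnth_nth !tnth_mktuple.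
Qed.

(** All fibres of the orbit map have the same size, so uniform permutations
induce the uniform law on the multislice. *)
Lemma stabilizer_coset (w : 'rV[R]_N) : multislice kappa x w ->
  #|[pred s : 'S_N | col_perm s w0 == w]| = #|[pred s : 'S_N | col_perm s w0 == w0]|.
Proof.
rewrite multislice_orbit => -[s0 _ <-].
rewrite -!sum1_card (reindex_inj (mulgI s0)); apply: eq_bigl => s.
rewrite !inE col_permM (inj_eq (can_inj (g := col_perm s0^-1) _))// => v.
by rewrite -col_permM mulVg col_perm1.
Qed.

Lemma multislice_count (B : set 'rV[R]_N) :
  (\sum_(s : 'S_N) `[< B (col_perm s w0) >]
   = #|` fset_set (multislice kappa x `&` B)|
     * #|[pred s : 'S_N | col_perm s w0 == w0]|)%N.
Proof.
have fin : finite_set (multislice kappa x `&` B).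
  apply: finite_setIl; rewrite multislice_orbit; apply: finite_image.
  exact: finite_finset.
set X := fset_set _.
transitivity (\sum_(s : 'S_N) \sum_(w <- X) (col_perm s w0 == w))%N.
  apply: eq_bigr => s _.
  rewrite [RHS](eq_bigr (fun w => if w == col_perm s w0 then 1 else 0)%N); last first.
    by move=> w _; rewrite eq_sym; case: eqP.
  rewrite -big_mkcond sum1_count count_uniq_mem ?finmap.fset_uniq//.
  congr nat_of_bool; apply/asboolP/idP => [Bs|].
    by rewrite in_fset_set// inE; split=> //; rewrite multislice_orbit; exists s.
  by rewrite in_fset_set// inE => -[].
rewrite exchange_big/= big_seq (eq_bigr (fun=> #|[pred s : 'S_N | col_perm s w0 == w0]|)).
  rewrite -big_seq big_const_seq count_predT iter_addn_0 mulnC//.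
move=> w; rewrite in_fset_set// inE => -[wm _].
rewrite -(stabilizer_coset wm) -sum1_card [RHS]big_mkcond/=.
by apply: eq_bigr => s _; rewrite inE; case: eqP.
Qed.

Lemma multislice_prob_mean (B : set 'rV[R]_N) :
  multislice_prob kappa x B
  = mean (fun s : 'S_N => (`[< B (col_perm s w0) >] : nat)%:R) :> R.
Proof.
set K := #|[pred s : 'S_N | col_perm s w0 == w0]|.
have K0 : (0 < K)%N.
  by apply/card_gt0P; exists 1%g; rewrite inE col_perm1.
have card_perms : (#|{perm 'I_N}| = #|` fset_set (@multislice R L kappa x N)| * K)%N.
  have h := multislice_count setT; rewrite setIT -/K in h.
  rewrite -h.
  by rewrite -sum1_card; apply: eq_bigr => s _; rewrite asboolT.
rewrite /mean -natr_sum multislice_count -/K card_perms !natrM.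
have K0' : K%:R != 0 :> R by rewrite pnatr_eq0 -lt0n.
rewrite invfM mulrACA divff// mulr1//.
Qed.

End Orbit.

(** * The convex distance *)

Section ConvexDistance.
Variables (R : realType) (n : nat) (A : set 'rV[R]_n).
Implicit Types (a w v : 'rV[R]_n).
Hypothesis n_gt0 : (0 < n)%N.
Hypothesis A0 : A !=set0.

Definition weighted_hamming a w : R :=
  inf [set \sum_(i < n) `|a 0 i| * (w 0 i != w' 0 i)%:R | w' in A].

Lemma weighted_hamming_le a w w' : A w' ->
  weighted_hamming a w <= \sum_(i < n) `|a 0 i| * (w 0 i != w' 0 i)%:R.
Proof.
move=> Aw'; apply: ge_inf; last by exists w'.
by exists 0 => _ [v _ <-]; apply: sumr_ge0 => i _; rewrite mulr_ge0.
Qed.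

Lemma weighted_hamming_ge a w (b : R) :
  (forall w', A w' -> b <= \sum_(i < n) `|a 0 i| * (w 0 i != w' 0 i)%:R) ->
  b <= weighted_hamming a w.
Proof.
move=> h; apply: lb_le_inf; last by move=> _ [w' Aw' <-]; exact: h.
by case: A0 => w' Aw'; exists (\sum_(i < n) `|a 0 i| * (w 0 i != w' 0 i)%:R); exists w'.
Qed.

Lemma weighted_hamming_ge0 a w : 0 <= weighted_hamming a w.
Proof.
by apply: weighted_hamming_ge => w' _; apply: sumr_ge0 => i _; rewrite mulr_ge0.
Qed.

Lemma weighted_hamming_update a w v (j : 'I_n) :
  (forall i, i != j -> v 0 i = w 0 i) ->
  weighted_hamming a w <= weighted_hamming a v + `|a 0 j|.
Proof.
move=> vw; rewrite -lerBlDr; apply: weighted_hamming_ge => w' Aw'.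
rewrite lerBlDr; apply: (le_trans (weighted_hamming_le a w Aw')).
rewrite (bigD1 j)//= [leRHS]addrC lerD//.
  by rewrite ler_piMr// lern1 leq_b1.
rewrite [leRHS](bigD1 j)//= ler_wpDl ?mulr_ge0// ler_sum// => i ij.
by rewrite vw.
Qed.

Lemma unit_coord_le1 a i : euclidean_norm a = 1 -> `|a 0 i| <= 1.
Proof.
move=> a1; rewrite -a1 /euclidean_norm -sqrtr_sqr ler_wsqrtr// (bigD1 i)//= lerDl.
by apply: sumr_ge0 => j _; exact: sqr_ge0.
Qed.

Lemma unit_sum_sq a : euclidean_norm a = 1 -> \sum_(i < n) a 0 i ^+ 2 = 1.
Proof.
move=> a1; rewrite -(sqr_sqrtr (a := \sum_i _)).
  by rewrite -/(euclidean_norm a) a1 expr1n.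
by apply: sumr_ge0 => j _; exact: sqr_ge0.
Qed.

Lemma has_sup_distance w :
  has_sup [set weighted_hamming a w | a in [set a | euclidean_norm a = 1]].
Proof.
split.
  pose i0 := Ordinal n_gt0; pose a : 'rV[R]_n := \row_i (i == i0)%:R.
  exists (weighted_hamming a w); exists a => //=.
  rewrite /euclidean_norm (bigD1 i0)//= big1 => [|i /negPf ii0].
    by rewrite mxE eqxx expr1n addr0 sqrtr1.
  by rewrite mxE ii0 expr0n.
exists n%:R => _ [a /= a1 <-]; have [w' Aw'] := A0.
apply: (le_trans (weighted_hamming_le a w Aw')).
rewrite -[X in _ <= X%:R](card_ord n) -sum1_card natr_sum ler_sum// => i _.
by rewrite mulr_ile1 ?unit_coord_le1// lern1 leq_b1.
Qed.

Lemma weighted_hamming_le_distance a w : euclidean_norm a = 1 ->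
  weighted_hamming a w <= convex_distance w A.
Proof. by move=> a1; apply: sup_upper_bound (has_sup_distance w) _ _; exists a. Qed.

Lemma convex_distance_ge0 w : 0 <= convex_distance w A.
Proof.
have [[_ [a a1 _]] _] := has_sup_distance w.
exact: le_trans (weighted_hamming_ge0 a w) (weighted_hamming_le_distance w a1).
Qed.

Lemma convex_distance_eq0 w : A w -> convex_distance w A = 0.
Proof.
move=> Aw; apply/eqP; rewrite eq_le convex_distance_ge0 andbT.
apply: ge_sup; first by case: (has_sup_distance w).
move=> _ [a _ <-]; apply: (le_trans (weighted_hamming_le a w Aw)).
by rewrite big1// => i _; rewrite eqxx mulr0.
Qed.

(** One near-optimal weight [a] for [w] controls all the [v j] at once: the
distance of [v j] is at least its weighted Hamming distance for [a], which drops
by at most [`|a 0 j|].  The supremum need not be attained, so [a] is optimal up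
to [d], and [(`|a 0 j| + d) ^+ 2 <= a 0 j ^+ 2 + 3 * d]. *)
Lemma convex_distance_gradient w (v : 'I_n -> 'rV[R]_n) :
  (forall j i, i != j -> v j 0 i = w 0 i) ->
  \sum_j Num.max (convex_distance w A - convex_distance (v j) A) 0 ^+ 2 <= 1.
Proof.
move=> vw; apply/ler_addgt0Pr => e e0.
pose d := Num.min 1 (e / (3 * n%:R)).
have n0 : 0 < n%:R :> R by rewrite ltr0n.
have d0 : 0 < d by rewrite /d lt_min ltr01 divr_gt0// mulr_gt0.
have [_ [a a1 <-] da] := sup_adherent d0 (has_sup_distance w).
have inc j : Num.max (convex_distance w A - convex_distance (v j) A) 0 <= `|a 0 j| + d.
  rewrite ge_max addr_ge0 ?(ltW d0)// andbT.
  have := weighted_hamming_update a (vw j).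
  have := weighted_hamming_le_distance (v j) a1.
  move: da; rewrite -/(convex_distance w A); lra.
apply: (@le_trans _ _ (\sum_j (a 0 j ^+ 2 + e / n%:R))).
  apply: ler_sum => j _.
  apply: (@le_trans _ _ ((`|a 0 j| + d) ^+ 2)).
    by rewrite ler_sqr ?nnegrE ?inc ?addr_ge0 ?(ltW d0)// le_max lexx orbT.
  have aj := unit_coord_le1 j a1; have aj0 := normr_ge0 (a 0 j).
  have d1 : d <= 1 by rewrite /d ge_min lexx.
  have de : 3 * d <= e / n%:R.
    have : d <= e / (3 * n%:R) by rewrite /d ge_min lexx orbT.
    have -> : e / (3 * n%:R) = e / n%:R / 3 by field; rewrite gt_eqF.
    by lra.
  rewrite sqrrD real_normK ?num_real//; nra.
rewrite big_split/= unit_sum_sq// sumr_const card_ord -(mulr_natr (e / _)).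
by rewrite mulfVK ?gt_eqF.
Qed.

Lemma convex_distance_perm (s : 'S_n) w : symmetric_set A ->
  convex_distance (col_perm s w) A = convex_distance w A.
Proof.
move=> Asym.
suff le t u : convex_distance (col_perm t u) A <= convex_distance u A.
  apply/eqP; rewrite eq_le le/=.
  by rewrite -[in leLHS](col_perm1 w) -(mulVg s) col_permM le.
apply: ge_sup; first by case: (has_sup_distance (col_perm t u)).
move=> _ [a /= a1 <-].
have b1 : euclidean_norm (col_perm t^-1 a) = 1.
  rewrite -a1 /euclidean_norm; congr Num.sqrt.
  by rewrite [RHS](reindex_inj (@perm_inj _ t^-1)); apply: eq_bigr => i _; rewrite mxE.
apply: le_trans (weighted_hamming_le_distance u b1).
apply: weighted_hamming_ge => w' /(Asym t) Aw'.
apply: (le_trans (weighted_hamming_le a _ Aw')).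
rewrite [leRHS](reindex_inj (@perm_inj _ t)); apply: ler_sum => i _.
by rewrite !mxE permK.
Qed.

End ConvexDistance.

(** * Transpositions across the first n positions *)

Section TwoBlocks.
Variables (R : realType) (n N : nat) (le_nN : (n <= N)%N).

Lemma sum_two_blocks_le (h : 'I_N -> 'I_N -> R) :
  (forall i j, h i j = h j i) ->
  (forall i j : 'I_N, ((i < n) == (j < n))%N -> h i j = 0) ->
  (forall j : 'I_N, (n <= j)%N -> \sum_(i < n) h (widen_ord le_nN i) j <= 1) ->
  \sum_i \sum_j h i j <= 2 * (N%:R - n%:R).
Proof.
move=> hC h0 h1.
pose S := \sum_(j : 'I_N | ~~ (j < n)%N) \sum_(i : 'I_N | (i < n)%N) h i j.
have -> : \sum_i \sum_j h i j = 2 * S.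
  rewrite (bigID (fun i : 'I_N => (i < n)%N))/= mulrDl !mul1r; congr (_ + _).
    rewrite /S [RHS]exchange_big/=; apply: eq_bigr => i i_n.
    rewrite (bigID (fun j : 'I_N => (j < n)%N))/= big1 ?add0r// => j j_n.
    by rewrite h0// i_n j_n.
  apply: eq_bigr => i i_n.
  rewrite (bigID (fun j : 'I_N => (j < n)%N))/= [X in _ + X]big1 ?addr0.
    by apply: eq_bigr => j _; exact: hC.
  by move=> j j_n; rewrite h0// (negPf i_n) (negPf j_n).
rewrite ler_pM2l//.
apply: (@le_trans _ _ (\sum_(j : 'I_N | ~~ (j < n)%N) 1)).
  apply: ler_sum => j; rewrite -leqNgt => nj.
  by rewrite (big_ord_narrow le_nN) h1.
have : \sum_(j : 'I_N) (1 : R) = N%:R by rewrite sumr_const card_ord.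
rewrite (bigID (fun j : 'I_N => (j < n)%N))/= (big_ord_narrow le_nN).
rewrite sumr_const card_ord; lra.
Qed.

Lemma gaussian_tail_concentration (f : {perm 'I_N} -> R) (t : R) :
  (0 < n)%N -> (forall s, 0 <= f s) ->
  (forall s, \sum_i \sum_j Num.max (f s - f (tperm i j * s)%g) 0 ^+ 2
     <= 2 * (N%:R - n%:R)) ->
  1 / 2 <= mean (fun s => (f s == 0)%:R) :> R -> 0 <= t ->
  mean (fun s => ((t <= f s)%R : nat)%:R) <= expR 1 * gaussian_tail n N t.
Proof.
move=> n_gt0 f0 fW half t0.
have N_gt0 : (0 < N)%N by exact: leq_trans le_nN.
have N0 : 0 < N%:R :> R by rewrite ltr0n.
have P_gt0 : (0 < #|{perm 'I_N}|)%N by apply/card_gt0P; exists 1%g.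
have T_gt0 : (0 < #|'I_N|)%N by rewrite card_ord.
pose c : R := 2 * (N%:R - n%:R) / N%:R.
have c0 : 0 <= c by rewrite /c divr_ge0 ?mulr_ge0// subr_ge0 ler_nat.
have bound l : 0 < l -> log_mgf f l <= l * mean f + c * l ^+ 2.
  move=> l0; apply: herbst => // k k0.
  by have := exp_entropy_le fW T_gt0 k0; rewrite [X in _ / X%:R * _ * _]card_ord.
rewrite /gaussian_tail; case: eqVneq => [nN|nN].
  have cE : c = 0 by rewrite /c nN subrr mulr0 mul0r.
  have [->|tN0] := eqVneq t 0.
    rewrite mulr1; apply: (@le_trans _ _ 1); last by rewrite -[leLHS]expR0 ler_expR.
    rewrite ler_pdivrMr ?ltr0n// mul1r -sum1_card natr_sum ler_sum// => s _.
    by rewrite ler_nat leq_b1.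
  rewrite mulr0 (tail_eq0 P_gt0 f0 c0 bound half cE)// lt_neqAle t0 eq_sym tN0//.
have cgt0 : 0 < c.
  by rewrite divr_gt0// mulr_gt0// subr_gt0 ltr_nat ltn_neqAle nN.
apply: (le_trans (tail_le P_gt0 f0 c0 bound half cgt0 t0)).
rewrite (_ : 8 * c = 16 * (1 - n%:R / N%:R))//.
by rewrite /c; field; rewrite gt_eqF.
Qed.

End TwoBlocks.

Lemma proj_col_perm_inner (R : realType) (n N : nat) (le_nN : (n <= N)%N)
    (w : 'rV[R]_N) (i j : 'I_n) :
  proj_first le_nN (col_perm (tperm (widen_ord le_nN i) (widen_ord le_nN j)) w)
  = col_perm (tperm i j) (proj_first le_nN w).
Proof.
apply/rowP => k; rewrite !mxE; congr (w _ _).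
by rewrite -inj_tperm//; move=> a b /(congr1 val) /= ab; exact: val_inj.
Qed.

Lemma proj_col_perm_outer (R : realType) (n N : nat) (le_nN : (n <= N)%N)
    (w : 'rV[R]_N) (i j : 'I_N) : (n <= i)%N -> (n <= j)%N ->
  proj_first le_nN (col_perm (tperm i j) w) = proj_first le_nN w.
Proof.
move=> ni nj; apply/rowP => k; rewrite !mxE tpermD//; apply/eqP => e.
  by have := ltn_ord k; rewrite ltnNge; move: ni; rewrite e /= => ->.
by have := ltn_ord k; rewrite ltnNge; move: nj; rewrite e /= => ->.
Qed.

Lemma proj_col_perm_cross (R : realType) (n N : nat) (le_nN : (n <= N)%N)
    (w : 'rV[R]_N) (i : 'I_n) (j : 'I_N) (k : 'I_n) : (n <= j)%N -> k != i ->
  proj_first le_nN (col_perm (tperm (widen_ord le_nN i) j) w) 0 k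
  = proj_first le_nN w 0 k.
Proof.
move=> nj ki; rewrite !mxE tpermD//; apply/eqP => e.
  by move/negP: ki; apply; apply/eqP/val_inj; rewrite /= -[LHS](congr1 val e).
by have := ltn_ord k; rewrite ltnNge; move: nj; rewrite e /= => ->.
Qed.

Theorem theorem1p10 (R : realType) (L : nat) (L_ge2 : (2 <= L)%N)
  (kappa : 'I_L -> nat) (kappa_gt0 : forall l, (0 < kappa l)%N)
  (N : nat) (N_def : N = (\sum_(l < L) kappa l)%N)
  (x : 'I_L -> R) (x_inj : injective x)
  (n : nat) (n_gt0 : (1 <= n)%N) (le_nN : (n <= N)%N)
  (A : set 'rV[R]_n) (A_sub : A `<=` multislice_proj kappa x le_nN)
  (A_sym : symmetric_set A)
  (A_half : 1 / 2 <= multislice_proj_prob kappa x le_nN A)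
  (t : R) (t_ge0 : 0 <= t) :
  multislice_proj_prob kappa x le_nN [set w | t <= convex_distance w A]
    <= expR 1 * gaussian_tail n N t.
Proof.
have [w0 [w0P Aw0]] : exists w, multislice kappa x w /\ A (proj_first le_nN w).
  apply: contrapT => no; move: A_half; apply/negP; rewrite -ltNge.
  rewrite /multislice_proj_prob /multislice_prob (_ : _ `&` _ = set0).
    by rewrite fset_set0 finmap.cardfs0 mul0r divr_gt0.
  by apply/seteqP; split=> // w /= [wm wA]; apply: no; exists w.
have A0 : A !=set0 by exists (proj_first le_nN w0).
move: A_half; rewrite /multislice_proj_prob !(multislice_prob_mean w0P).
pose p s := proj_first le_nN (col_perm s w0).
pose f s := convex_distance (p s) A.
have fE (s : 'S_N) i j :
    f (tperm i j * s)%g =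
    convex_distance (proj_first le_nN (col_perm (tperm i j) (col_perm s w0))) A.
  by rewrite /f /p col_permM.
move=> half.
have -> : mean (fun s : 'S_N =>
    (`[< (proj_first le_nN @^-1` [set w | t <= convex_distance w A])
           (col_perm s w0) >] : nat)%:R : R)
   = mean (fun s => ((t <= f s)%R : nat)%:R).
  rewrite /mean; congr (_ / _); apply: eq_bigr => s _; congr (_%:R); congr nat_of_bool.
  by rewrite /= asboolb.
apply: gaussian_tail_concentration => //.
- by move=> s; exact: convex_distance_ge0.
- move=> s; apply: sum_two_blocks_le => [i j|i j ij|j nj].
  + by rewrite tpermC.
  + rewrite fE (_ : convex_distance _ A = f s) ?subrr ?maxxx ?expr0n//.
    move: ij; case: (ltnP i n) => [i_n|ni]; case: (ltnP j n) => [j_n|nj] // _.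
      have -> : i = widen_ord le_nN (Ordinal i_n) by exact: val_inj.
      have -> : j = widen_ord le_nN (Ordinal j_n) by exact: val_inj.
      by rewrite proj_col_perm_inner convex_distance_perm.
    by rewrite proj_col_perm_outer.
  + under eq_bigr do rewrite fE.
    apply: convex_distance_gradient => // i k ki.
    exact: proj_col_perm_cross.
- apply: le_trans half _; apply: (mean_le (I := {perm 'I_N})).
    by apply/card_gt0P; exists 1%g.
  move=> s; case: asboolP => [As|_]; last by rewrite ler0n.
  by rewrite /f convex_distance_eq0// eqxx.
Qed.
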